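(* Let $\mathbb S$ be a relational structure in a finite signature. If $\mathbb S$ is finitely bounded, then $\mathrm{CSP}(\mathbb S)$ is in monotone extensional SNP. Moreover, if $\mathbb S$ has a finite set of connected bounds, then $\mathrm{CSP}(\mathbb S)$ is in monotone connected extensional SNP.
   Context: All structures have non-empty (possibly infinite) domains. $\mathrm{CSP}(\mathbb S)$ is the class of finite structures in the signature of $\mathbb S$ that admit a homomorphism to $\mathbb S$. A set $\mathcal F$ of finite structures is a set of bounds of $\mathbb S$ if a finite structure $\mathbb A$ embeds into $\mathbb S$ if and only if no structure from $\mathcal F$ embeds into $\mathbb A$; $\mathbb S$ is finitely bounded if it has a finite set of bounds. A structure is connected if it is not the disjoint union of two structures; a set of connected bounds is a set of bounds all of whose members are connected. An SNP $\tau$-sentence has the form $\exists R_1,\dots,R_k\,\forall x_1,\dots,x_n.\,\psi$ with $\psi$ a quantifier-free $(\tau\cup\{R_1,\dots,R_k\})$-formula, taken in conjunctive normal form, where $R_1,\dots,R_k\notin\tau$. Such a sentence is: - extensional if for every existentially quantified symbol $R$ there is a distinct symbol $R'\in\tau$ of the same arity such that the first-order part contains the clause $R'(\bar x)\Rightarrow R(\bar x)$, and $R'$ does not appear in any other clause; - monotone if every symbol from $\tau\cup\{=\}$ occurs in $\psi$ only in negated literals; - connected if $\psi$ contains no positive literal $x=y$ and every clause $C$ of $\psi$ is connected, meaning that the structure whose domain is the set of variables of $C$, and in which $\bar x$ is in relation $R$ iff $C$ contains the negative literal $\lnot R(\bar x)$, is connected. A class of finite $\tau$-structures is in one of these fragments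 if it is the class of finite models of some $\tau$-sentence of the fragment. *)

(* Defs.v *)
From mathcomp Require Import all_boot.
From Stdlib Require FinFun.

Set Implicit Arguments.
Unset Strict Implicit.
Unset Printing Implicit Defensive.

Record signature := Signature { sym :> finType; arity : sym -> nat }.
Arguments arity {s} R.

(* Nonemptiness of the domain is not a field, because the structure attached to
   a clause has an empty domain when the clause has no variables.  It is imposed
   separately, on [S] and in [fin_structure]. *)
Record structure (tau : signature) := Structure {
  dom :> Type;
  rel_of : forall R : tau, (arity R).-tuple dom -> Prop }.

Definition nonempty (tau : signature) (A : structure tau) : Prop := inhabited A.

Definition fin_structure (tau : signature) (A : structure tau) : Prop :=
  nonempty A /\ FinFun.Finite A.

Definition homomorphism (tau : signature) (A B : structure tau) (h : A -> B) :=
  forall (R : tau) (t : (arity R).-tuple A),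
    rel_of t -> rel_of (s := B) (map_tuple h t).

Definition embedding (tau : signature) (A B : structure tau) (h : A -> B) :=
  injective h /\
  forall (R : tau) (t : (arity R).-tuple A),
    rel_of t <-> rel_of (s := B) (map_tuple h t).

Definition isomorphism (tau : signature) (A B : structure tau) (h : A -> B) :=
  embedding h /\ bijective h.

Definition embeds (tau : signature) (A B : structure tau) : Prop :=
  exists h : A -> B, embedding h.

Definition isomorphic (tau : signature) (A B : structure tau) : Prop :=
  exists h : A -> B, isomorphism h.

Definition disjoint_union (tau : signature) (A B : structure tau) :
    structure tau :=
  {| dom := (A + B)%type;
     rel_of := fun R t =>
       (exists2 a : (arity R).-tuple A, rel_of a & t = map_tuple inl a) \/
       (exists2 b : (arity R).-tuple B, rel_of b & t = map_tuple inr b) |}.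

Definition connected (tau : signature) (A : structure tau) : Prop :=
  ~ exists B C : structure tau,
      [/\ nonempty B, nonempty C & isomorphic A (disjoint_union B C)].

Definition CSP (tau : signature) (S A : structure tau) : Prop :=
  fin_structure A /\ exists h : A -> S, homomorphism h.

Definition set_of_bounds (tau : signature) (Fs : structure tau -> Prop)
    (S : structure tau) : Prop :=
  (forall F, Fs F -> fin_structure F) /\
  (forall A : structure tau, fin_structure A ->
     (embeds A S <-> ~ exists2 F, Fs F & embeds F A)).

Definition finitely_bounded (tau : signature) (S : structure tau) : Prop :=
  exists Fs : seq (structure tau), set_of_bounds (fun F => List.In F Fs) S.

Definition has_finite_connected_bounds (tau : signature) (S : structure tau) :
    Prop :=
  exists Fs : seq (structure tau),
    set_of_bounds (fun F => List.In F Fs) S /\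
    (forall F, List.In F Fs -> connected F).

Definition sig_union (tau sigma : signature) : signature :=
  {| sym := (tau + sigma)%type : finType;
     arity := fun R => match R with inl P => arity P | inr P => arity P end |}.

Definition expansion (tau sigma : signature) (A : structure tau)
    (rho : forall R : sigma, (arity R).-tuple A -> Prop) :
    structure (sig_union tau sigma) :=
  {| dom := A;
     rel_of := fun R : sig_union tau sigma =>
       match R return (@arity (sig_union tau sigma) R).-tuple A -> Prop with
       | inl P => @rel_of tau A P
       | inr P => rho P
       end |}.

Inductive atom (tau : signature) (n : nat) : Type :=
| Rel (R : tau) (x : (arity R).-tuple 'I_n)
| Equal (i j : 'I_n).
Arguments Rel {tau n} R x.
Arguments Equal {tau n} i j.

Inductive literal (tau : signature) (n : nat) : Type :=
| Pos (a : atom tau n)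
| Neg (a : atom tau n).
Arguments Pos {tau n} a.
Arguments Neg {tau n} a.

Definition atom_of (tau : signature) (n : nat) (l : literal tau n) :=
  match l with Pos a => a | Neg a => a end.

(* A clause is the disjunction of its literals, and a CNF formula is the
   conjunction of its clauses. *)
Definition clause (tau : signature) (n : nat) := seq (literal tau n).
Definition cnf (tau : signature) (n : nat) := seq (clause tau n).

Definition atom_holds (tau : signature) (n : nat) (A : structure tau)
    (v : 'I_n -> A) (a : atom tau n) : Prop :=
  match a with
  | Rel R x => rel_of (s := A) (map_tuple v x)
  | Equal i j => v i = v j
  end.

Definition literal_holds (tau : signature) (n : nat) (A : structure tau)
    (v : 'I_n -> A) (l : literal tau n) : Prop :=
  match l with Pos a => atom_holds v a | Neg a => ~ atom_holds v a end.

Definition clause_holds (tau : signature) (n : nat) (A : structure tau)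
    (v : 'I_n -> A) (C : clause tau n) : Prop :=
  exists2 l, List.In l C & literal_holds v l.

Definition cnf_holds (tau : signature) (n : nat) (A : structure tau)
    (v : 'I_n -> A) (psi : cnf tau n) : Prop :=
  forall C, List.In C psi -> clause_holds v C.

(* The sum of signatures makes the quantified symbols [esig] disjoint from
   [tau]. *)
Record snp_sentence (tau : signature) := SNP {
  esig : signature;
  nvars : nat;
  matrix_of : cnf (sig_union tau esig) nvars }.

Definition models (tau : signature) (A : structure tau)
    (phi : snp_sentence tau) : Prop :=
  exists rho : forall R : esig phi, (arity R).-tuple A -> Prop,
  forall v : 'I_(nvars phi) -> A,
    cnf_holds (A := expansion rho) v (matrix_of phi).

Definition rel_occurs (tau : signature) (n : nat) (R : tau)
    (C : clause tau n) : Prop :=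
  exists2 l, List.In l C & exists x, atom_of l = Rel R x.

(* [R'(x) => R(x)], where [x] has the length of both [R'] and [R]. *)
Definition extension_clause (tau sigma : signature) (n : nat)
    (R' : tau) (R : sigma) (e : arity R' = arity R)
    (x : (arity R').-tuple 'I_n) : clause (sig_union tau sigma) n :=
  [:: Neg (@Rel (sig_union tau sigma) n (inl R') x);
      Pos (@Rel (sig_union tau sigma) n (inr R) (tcast e x))].

(* With a repeated variable in [x], the clause would not express that [R']
   is contained in [R]; hence [uniq x]. *)
Definition extensional (tau : signature) (phi : snp_sentence tau) : Prop :=
  exists2 input : esig phi -> tau, injective input &
  forall R : esig phi,
  exists (e : arity (input R) = arity R)
         (x : (arity (input R)).-tuple 'I_(nvars phi)),
    [/\ uniq x,
        List.In (extension_clause e x) (matrix_of phi)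
      & forall C, List.In C (matrix_of phi) -> C <> extension_clause e x ->
          ~ @rel_occurs (sig_union tau (esig phi)) _ (inl (input R)) C].

Definition input_atom (tau sigma : signature) (n : nat)
    (a : atom (sig_union tau sigma) n) : Prop :=
  match a with
  | Rel (inl _) _ => True
  | Rel (inr _) _ => False
  | Equal _ _ => True
  end.

Definition monotone (tau : signature) (phi : snp_sentence tau) : Prop :=
  forall C a, List.In C (matrix_of phi) -> List.In (Pos a) C -> ~ input_atom a.

Definition var_in_atom (tau : signature) (n : nat) (i : 'I_n)
    (a : atom tau n) : bool :=
  match a with
  | Rel R x => i \in x
  | Equal j k => (i == j) || (i == k)
  end.

Definition var_in_clause (tau : signature) (n : nat) (C : clause tau n)
    (i : 'I_n) : bool :=
  has (fun l => var_in_atom i (atom_of l)) C.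

Definition clause_structure (tau : signature) (n : nat) (C : clause tau n) :
    structure tau :=
  {| dom := {i : 'I_n | var_in_clause C i};
     rel_of := fun R t => List.In (Neg (Rel R (map_tuple sval t))) C |}.

Definition connected_snp (tau : signature) (phi : snp_sentence tau) : Prop :=
  forall C, List.In C (matrix_of phi) ->
    (forall i j, ~ List.In (Pos (Equal i j)) C) /\
    connected (clause_structure C).

Definition finite_models_of (tau : signature) (phi : snp_sentence tau)
    (A : structure tau) : Prop :=
  fin_structure A /\ models A phi.

Definition in_monotone_extensional_SNP (tau : signature)
    (K : structure tau -> Prop) : Prop :=
  exists phi : snp_sentence tau,
    [/\ monotone phi, extensional phi
      & forall A, K A <-> finite_models_of phi A].

Definition in_monotone_connected_extensional_SNP (tau : signature)
    (K : structure tau -> Prop) : Prop :=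
  exists phi : snp_sentence tau,
    [/\ monotone phi, connected_snp phi, extensional phi
      & forall A, K A <-> finite_models_of phi A].

(* Main.v *)
From mathcomp.classical Require Import boolp.
Require Import Defs.
From mathcomp Require Import all_boot.

Set Implicit Arguments.
Unset Strict Implicit.
Unset Printing Implicit Defensive.

(** A finite structure [A] maps homomorphically to [S] exactly when its
    relations can be enlarged to relations [rho] such that [M = (A, rho)] has a
    strong homomorphism to [S], one that preserves and reflects all relations:
    take for [rho] the preimage of the relations of [S].  The sentence
    [theory_sentence] guesses [rho], with one quantified symbol for each input
    symbol and one clause saying that the former contains the latter.  Its other
    clauses are all the clauses in the guessed symbols, over a fixed number of
    variables and without equality, that hold in [S]; in the connected case,
    only those that are connected.  There are finitely many of them, and they
    hold in the preimage structure, since the truth of an equality-free clause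
    is preserved by taking preimages ([theory_sound]).

    The substance is the converse ([theory_complete]).  Equality cannot be
    guessed in an extensional sentence, so the kernel of the wanted map has to be
    read off from [rho].  Call two elements of [M] twins if exchanging one for
    the other in any position of any tuple does not affect membership in a
    relation.  Representatives of the twin classes form a substructure [B] of
    [M], and sending each element to its representative is a strong
    homomorphism.  If [B] embeds in [S], the composite is the homomorphism that
    is sought.  Otherwise some bound [F] embeds in [B], hence in [M], with image
    consisting of pairwise non-twins ([hom_or_untwinned_bound]).  For each pair
    of distinct elements of this image, choose a tuple that belongs to a relation
    and leaves it when one element of the pair is substituted for an occurrence
    of the other.  The image of [F] together with these tuples is a set of
    elements whose size is bounded in terms of [F] ([separating_cover]).
    Consider the clause that says that its [diagram], the complete list of the
    guessed atoms true and false on it, is not realised.  This clause fails in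
    [M].  It holds in [S]: a realisation of the diagram in [S] gives a strong map
    from [F] to [S], and the separating tuples force that map to be injective, so
    [F] would embed in [S], whereas no bound of [S] does.  Hence the clause is
    one of those of the sentence, and [M] violates it.

    In the connected case this clause is connected too: the image of [F] is
    connected, and each separating tuple lies in a relation and contains an
    element of that image ([diagram_connected]).  Connectedness is handled
    throughout by two-colourings of the domain that are constant on each tuple of
    each relation: a structure is connected if and only if they are all constant. *)

(** * Enumerations *)

Lemma In_mem (T : eqType) (x : T) (s : seq T) : List.In x s <-> x \in s.
Proof.
elim: s => [//|y s IHs]; rewrite in_cons /=; split.
  by case=> [->|/IHs ->]; rewrite ?eqxx ?orbT.
by case/predU1P => [->|/IHs]; [left | right].
Qed.

Lemma In_nth_seq (T : Type) (x0 x : T) (s : seq T) :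
  List.In x s -> exists2 i, i < size s & nth x0 s i = x.
Proof.
elim: s => [//|y s IHs] /= [->|/IHs [i lt_is <-]]; first by exists 0.
by exists i.+1.
Qed.

(** The number of variables of the sentence must work for all the bounds, so
    they are enumerated by one and the same index set. *)
Lemma common_enumeration (tau : signature) (Fs : seq (structure tau)) :
    (forall F, List.In F Fs -> fin_structure F) ->
  exists m, forall F, List.In F Fs ->
    exists p : 'I_m.+1 -> F, forall f, exists i, p i = f.
Proof.
elim: Fs => [|F Fs IHs] finFs; first by exists 0.
have [|m enumFs] := IHs; first by move=> G inG; apply: finFs; right.
have [[f0] [l full_l]] := finFs F (or_introl erefl).
exists (maxn m (size l)) => G /= [<-|/enumFs [p surj_p]].
  exists (fun i => nth f0 l i) => f.
  have [i lt_il <-] := In_nth_seq f0 (full_l f).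
  have lt_iM : i < (maxn m (size l)).+1.
    by rewrite ltnS leq_max (ltnW lt_il) orbT.
  by exists (Ordinal lt_iM).
exists (fun i => p (inord i)) => f; have [i <-] := surj_p f.
have le_mM : m.+1 <= (maxn m (size l)).+1 by rewrite ltnS leq_maxl.
by exists (widen_ord le_mM i); rewrite /= inord_val.
Qed.

(** * Connectedness and two-colourings *)

Definition monochromatic (V : Type) (c : V -> bool) (n : nat)
    (t : n.-tuple V) : Prop :=
  forall i j, c (tnth t i) = c (tnth t j).

(** Otherwise the two colour classes, with the induced relations, would
    exhibit [A] as a disjoint union. *)
Lemma connected_constant (tau : signature) (A : structure tau)
    (c : A -> bool) :
    connected A ->
    (forall R (t : (arity R).-tuple A), rel_of t -> monochromatic c t) ->
  forall x y, c x = c y.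
Proof.
move=> connA cmono.
suff no_split x y : c x -> ~~ c y -> False.
  move=> x y; case cx: (c x); case cy: (c y) => //; exfalso.
    by apply: (no_split x y); rewrite ?cx ?cy.
  by apply: (no_split y x); rewrite ?cx ?cy.
move=> cx cy; apply: connA.
pose part b := Structure (fun R (t : (arity R).-tuple {z : A | c z == b}) =>
                 rel_of (s := A) (map_tuple sval t)).
have csplit z : c z != true -> c z == false by case: (c z).
pose h z : disjoint_union (part true) (part false) :=
  match boolP (c z == true) with
  | AltTrue cz => inl (exist _ z cz)
  | AltFalse cz => inr (exist _ z (csplit z cz))
  end.
pose g (u : disjoint_union (part true) (part false)) : A :=
  match u with inl z => sval z | inr z => sval z end.
have hK : cancel h g by move=> z; rewrite /h; destruct (boolP (c z == true)).
have gK : cancel g h.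
  case=> [] [z cz]; rewrite /h /=;
    destruct (boolP (c z == true)) as [cz'|cz'].
  - by rewrite (bool_irrelevance cz' cz).
  - by case/negP: (cz').
  - by exfalso; move: cz'; rewrite (eqP cz).
  - by rewrite (bool_irrelevance (csplit z cz') cz).
exists (part true), (part false); split.
- by constructor; exists x; apply/eqP.
- by constructor; exists y; apply/eqP/negbTE.
exists h; split; last by exists g.
split; first exact: can_inj hK.
move=> R t; split=> [Rt|].
  have lift b : (forall i, c (tnth t i) == b) ->
      exists2 a : (arity R).-tuple (part b), rel_of a & map_tuple sval a = t.
    move=> ctb; have tE : map_tuple sval
        [tuple exist (fun z => c z == b) (tnth t i) (ctb i) | i < arity R] = t.
      by apply: eq_from_tnth => i; rewrite tnth_map tnth_mktuple.
    by eexists; last exact: tE; rewrite /= tE.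
  (* A tuple of length 0 counts as a tuple of the first part. *)
  have [ct|/forallPn [i0 /negbTE ci0]] := boolP [forall i, c (tnth t i)].
    have [a Ra tE] := lift true (fun i => introT eqP (forallP ct i)).
    left; exists a => //; apply: eq_from_tnth => i.
    by rewrite -tE !tnth_map -[LHS](gK) hK -[RHS]gK.
  have [i|a Ra tE] := lift false; first by rewrite (cmono _ _ Rt i i0) ci0.
  right; exists a => //; apply: eq_from_tnth => i.
  by rewrite -tE !tnth_map -[LHS](gK) hK -[RHS]gK.
have tE : t = map_tuple g (map_tuple h t).
  by apply: eq_from_tnth => i; rewrite !tnth_map hK.
have gE b (d : part b -> disjoint_union (part true) (part false)) a :
    (forall z, g (d z) = sval z) ->
    map_tuple g (map_tuple d a) = map_tuple sval a.
  by move=> gd; apply: eq_from_tnth => i; rewrite !tnth_map gd.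
by case=> [] [a Ra htE]; rewrite tE htE gE.
Qed.

(** Colouring all of ['I_n], not only the variables that occur in [C], spares
    later proofs the subtype on which [clause_structure] is built. *)
Lemma connected_clause (tau : signature) (n : nat) (C : clause tau n) :
    (forall c : 'I_n -> bool,
       (forall R x, List.In (Neg (Rel R x)) C -> monochromatic c x) ->
       forall i j, var_in_clause C i -> var_in_clause C j -> c i = c j) ->
  connected (clause_structure C).
Proof.
move=> constC [B [D [[b] [d] [h [[_ hrel] [g hK gK]]]]]].
pose left_of u := if h u is inl _ then true else false.
pose c i := if insub i is Some u then left_of u else false.
have cE u : c (sval u) = left_of u by rewrite /c valK.
have : c (sval (g (inl b))) = c (sval (g (inr d))).
  apply: constC (svalP (g (inl b))) (svalP (g (inr d))) => R x inC i j.
  have Vx k : var_in_clause C (tnth x k).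
    suff : List.In (Neg (Rel R x)) C -> var_in_clause C (tnth x k) by apply.
    rewrite /var_in_clause; elim: (C) => [//|l C' IHC] /= [->|/IHC ->].
      by rewrite /= mem_tnth.
    exact: orbT.
  pose t : (arity R).-tuple (clause_structure C) :=
    [tuple exist (fun i => var_in_clause C i) (tnth x k) (Vx k) | k < arity R].
  have tE : map_tuple sval t = x.
    by apply: eq_from_tnth => k; rewrite tnth_map tnth_mktuple.
  have Rt : rel_of t by rewrite /= tE.
  have colour_t k : c (tnth x k) = left_of (tnth t k) by rewrite -tE tnth_map cE.
  rewrite !colour_t /left_of.
  have hE k : h (tnth t k) = tnth (map_tuple h t) k by exact/esym/tnth_map.
  move: (hrel R t) => [/(_ Rt) ht _]; rewrite !hE.
  by case: ht => [] [a _ ->]; rewrite !tnth_map.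
by rewrite !cE /left_of !gK.
Qed.

(** * Twins *)

Section Twins.

Variables (tau : signature) (M : structure tau).

Definition tset (T : Type) (n : nat) (t : n.-tuple T) (k : 'I_n) (x : T) :
    n.-tuple T :=
  [tuple if i == k then x else tnth t i | i < n].

Definition twin (x y : M) : Prop :=
  forall R (t : (arity R).-tuple M) k,
    rel_of (tset t k x) <-> rel_of (tset t k y).

Definition separates (x y : M) R (t : (arity R).-tuple M) : Prop :=
  rel_of t /\ exists2 k, tnth t k = x & ~ rel_of (tset t k y).

Lemma tset_tset n (t : n.-tuple M) k x y : tset (tset t k x) k y = tset t k y.
Proof.
by apply: eq_from_tnth => i; rewrite !tnth_mktuple; case: (i == k).
Qed.

Lemma twin_refl x : twin x x.
Proof. by []. Qed.

Lemma twin_sym x y : twin x y -> twin y x.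
Proof. by move=> xy R t k; split=> /xy. Qed.

Lemma twin_trans x y z : twin x y -> twin y z -> twin x z.
Proof. by move=> xy yz R t k; split=> [/xy/yz|/yz/xy]. Qed.

Lemma not_twin x y : ~ twin x y ->
  exists R, exists t : (arity R).-tuple M, separates x y t \/ separates y x t.
Proof.
apply: contra_notP => nsep R t k.
have half u w : (forall R (t : (arity R).-tuple M), ~ separates u w t) ->
    rel_of (tset t k u) -> rel_of (tset t k w).
  move=> nuw Ru; apply: contrapT => nRw; apply: (nuw R (tset t k u)).
  by split=> //; exists k; rewrite ?tset_tset // tnth_mktuple eqxx.
by split; apply: half => R' t' s; apply: nsep; exists R', t'; [left | right].
Qed.

(** The tuple [t] is turned into [t'] one position at a time. *)
Lemma twin_rel R (t t' : (arity R).-tuple M) :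
  (forall i, twin (tnth t i) (tnth t' i)) -> rel_of t <-> rel_of t'.
Proof.
move=> tt'.
pose mix k := [tuple if i < k then tnth t' i else tnth t i | i < arity R].
have mixP k : k <= arity R -> rel_of t <-> rel_of (mix k).
  elim: k => [_|k IHk lt_k].
    suff -> : mix 0 = t by [].
    by apply: eq_from_tnth => i; rewrite tnth_mktuple.
  apply: (iff_trans (IHk (ltnW lt_k))).
  pose o := Ordinal lt_k.
  have -> : mix k = tset (mix k) o (tnth t o).
    apply: eq_from_tnth => i; rewrite !tnth_mktuple.
    by case: eqP => [->|//]; rewrite /= ltnn.
  have -> : mix k.+1 = tset (mix k) o (tnth t' o).
    apply: eq_from_tnth => i; rewrite !tnth_mktuple.
    case: eqP => [->|/eqP]; first by rewrite /= ltnSn.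
    by rewrite -val_eqE /= ltnS leq_eqVlt => /negbTE ->.
  exact: tt'.
suff <- : mix (arity R) = t' by exact: mixP.
by apply: eq_from_tnth => i; rewrite tnth_mktuple ltn_ord.
Qed.

(** Twins define the same predicate [twin x], and [rep x] is chosen as a
    function of this predicate. *)
Lemma twin_representatives :
  exists rep : M -> M, (forall x, twin x (rep x)) /\
    forall x y, twin x y -> rep x = rep y.
Proof.
have [|f fP] := @choice (M -> Prop) (option M)
    (fun P o => if o is Some x then P x else forall x, ~ P x).
  move=> P; have [[x Px]|nP] := pselect (exists x, P x).
    by exists (Some x).
  by exists None => x Px; apply: nP; exists x.
pose rep x := odflt x (f (twin x)); exists rep; split=> [x|x y xy].
  by rewrite /rep; move: (fP (twin x)); case: (f _).
have xyE : twin x = twin y.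
  apply/funext => z; apply/propext; split; last exact: twin_trans.
  by apply: twin_trans; apply: twin_sym.
rewrite /rep xyE; move: (fP (twin y)); case: (f _) => //= no.
by case: (no y (twin_refl y)).
Qed.

(** Two points of the substructure [B] of representatives are equal as soon as
    they are twins in [M]; this property passes to the image of any bound that
    embeds in [B]. *)
Lemma hom_or_untwinned_bound (Fs : structure tau -> Prop) (S : structure tau) :
    set_of_bounds Fs S -> fin_structure M ->
  (exists h : M -> S, homomorphism h) \/
  exists2 F, Fs F & exists2 e : F -> M,
    embedding e & forall f f', twin (e f) (e f') -> f = f'.
Proof.
move=> [_ boundS] [[a0] [l full_l]].
have [rep [repP rep_eq]] := twin_representatives.
have rep_id x : rep (rep x) = rep x by apply/esym/rep_eq.
pose B := Structure (fun R (t : (arity R).-tuple {x : M | rep x = x}) =>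
            rel_of (s := M) (map_tuple sval t)).
have sval_B : injective (sval : B -> M).
  by move=> [x Px] [y Py] /= xy; subst y; congr exist; apply: Prop_irrelevance.
pose cls x : B := exist _ (rep x) (rep_id x).
have finB : fin_structure B.
  split; first by constructor; exact: cls a0.
  exists (List.map cls l) => b.
  have -> : b = cls (sval b) by apply: sval_B; rewrite /= (svalP b).
  exact/List.in_map/full_l.
have [[g [_ grel]]|nembB] := pselect (embeds B S).
  left; exists (g \o cls) => R t Rt.
  have -> : map_tuple (g \o cls) t = map_tuple g (map_tuple cls t).
    by apply: eq_from_tnth => i; rewrite !tnth_map.
  apply/grel; move: Rt; apply: (iffLR (twin_rel _)) => i.
  by rewrite !tnth_map /=; apply: repP.
right; have [F FsF [e [e_inj erel]]] : exists2 F, Fs F & embeds F B.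
  by apply: contrapT => /(boundS B finB).
exists F => //; exists (sval \o e); last first.
  move=> f f' /rep_eq /=; rewrite (svalP (e f)) (svalP (e f')).
  by move/sval_B/e_inj.
split; first exact: inj_comp.
move=> R t; apply: (iff_trans (erel R t)) => /=.
suff -> : map_tuple sval (map_tuple e t) = map_tuple (sval \o e) t by [].
by apply: eq_from_tnth => i; rewrite !tnth_map.
Qed.

End Twins.

(** * Separating tuples for the image of a bound *)

Definition max_arity (tau : signature) := \max_(R : tau) arity R.

Lemma arity_le_max (tau : signature) (R : tau) : arity R <= max_arity tau.
Proof. exact: (leq_bigmax (F := @arity tau) R). Qed.

(** One variable for each of the [m.+1] points of a bound, and one for each
    position in each of the tuples chosen for the ordered pairs of points. *)
Definition num_vars (tau : signature) (m : nat) : nat :=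
  #|{: 'I_m.+1 + ('I_m.+1 * 'I_m.+1) * 'I_(max_arity tau)}|.

(** Makes room for a tuple of distinct variables for each symbol, as the
    extension clauses require. *)
Lemma arity_le_num_vars (tau : signature) (m : nat) (R : tau) :
  arity R <= num_vars tau m.
Proof.
rewrite /num_vars card_sum !card_prod !card_ord.
apply: (leq_trans (arity_le_max R)).
exact: leq_trans (leq_pmull _ _) (leq_addl _ _).
Qed.

Definition within (V T : Type) (v : V -> T) (n : nat) (t : n.-tuple T) :=
  forall k, exists i, v i = tnth t k.

(** The range of [v] consists of the image of [F] and the entries of one tuple
    for each separable ordered pair of points.  The last conjunct is what later
    makes the diagram of this range connected. *)
Lemma separating_cover (tau : signature) (m : nat) (F M : structure tau)
    (p : 'I_m.+1 -> F) (e : F -> M) :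
    (forall f, exists i, p i = f) ->
  exists v : 'I_(num_vars tau m) -> M,
  [/\ forall f, exists i, v i = e f,
      forall f f' R (t : (arity R).-tuple M), separates (e f) (e f') t ->
        exists R', exists2 t' : (arity R').-tuple M,
          separates (e f) (e f') t' & within v t'
    & forall i, exists f, v i = e f \/
        exists R, exists t : (arity R).-tuple M,
          [/\ rel_of t, within v t,
              exists k, tnth t k = v i & exists k, tnth t k = e f]].
Proof.
move=> surj_p.
pose spec (ij : 'I_m.+1 * 'I_m.+1) (s : seq M) :=
  (exists R, exists2 t : (arity R).-tuple M,
     separates (e (p ij.1)) (e (p ij.2)) t & s = t) \/
  (s = [::] /\ forall R (t : (arity R).-tuple M),
     ~ separates (e (p ij.1)) (e (p ij.2)) t).
have [|w wP] := @choice _ _ spec.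
  move=> ij; have [[R [t sep]]|nsep] := pselect (exists R,
      exists t : (arity R).-tuple M, separates (e (p ij.1)) (e (p ij.2)) t).
    by exists t; left; exists R, t.
  by exists [::]; right; split=> // R t sep; apply: nsep; exists R, t.
pose v0 (x : 'I_m.+1 + ('I_m.+1 * 'I_m.+1) * 'I_(max_arity tau)) : M :=
  match x with
  | inl i => e (p i)
  (* Positions beyond the end of [w ij], which is empty if no tuple separates
     the pair, repeat a point of the image. *)
  | inr (ij, k) => nth (e (p ij.1)) (w ij) k
  end.
pose v (i : 'I_(num_vars tau m)) := v0 (enum_val i).
have vE x : exists i, v i = v0 x.
  by exists (enum_rank x); rewrite /v enum_rankK.
have w_within ij (R : tau) (t : (arity R).-tuple M) : w ij = t -> within v t.
  move=> wt k; have lt_k : k < max_arity tau.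
    exact: leq_trans (ltn_ord k) (arity_le_max R).
  have [i vi] := vE (inr (ij, Ordinal lt_k)); exists i; rewrite vi /= wt.
  by rewrite -tnth_nth.
exists v; split=> [f|f f' R t|i].
- by have [i <-] := surj_p f; apply: (vE (inl i)).
- have [[i <-] [j <-]] := (surj_p f, surj_p f') => sep.
  have [[R' [t' sep' wt']]|[_ /(_ R t)]//] := wP (i, j).
  by exists R', t' => //; apply: w_within wt'.
rewrite /v; case: (enum_val i) => [j|[[j j'] k]] /=.
  by exists (p j); left.
exists (p j).
have [[R [t sep wt]]|[-> _]] := wP (j, j'); last by left; rewrite nth_nil.
have [lt_k|ge_k] := ltnP k (arity R); last first.
  by left; rewrite nth_default // wt size_tuple.
have [Rt [k' tk' _]] := sep.
right; exists R, t; split=> //; [exact: w_within wt | | by exists k'].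
by exists (Ordinal lt_k); rewrite wt (tnth_nth (e (p j))).
Qed.

(** * Diagrams as clauses in the guessed symbols *)

Section Diagrams.

Variables (tau : signature) (n : nat).

Definition ratom : finType := {R : tau & (arity R).-tuple 'I_n}.

Definition ratom_of (R : tau) (x : (arity R).-tuple 'I_n) : ratom :=
  Tagged (fun R : tau => (arity R).-tuple 'I_n) x.

(** The boolean is the sign of the literal.  Sets of such pairs form a finite
    type, which is what makes the list of all valid clauses finite. *)
Definition guessed_literal (l : bool * ratom) : literal (sig_union tau tau) n :=
  let a := @Rel (sig_union tau tau) n (inr (tag l.2)) (tagged l.2) in
  if l.1 then Pos a else Neg a.

Definition guessed_clause (s : {set bool * ratom}) :
    clause (sig_union tau tau) n :=
  map guessed_literal (enum s).

Lemma In_guessed (s : {set bool * ratom}) l :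
  List.In l (guessed_clause s) <-> exists2 a, a \in s & l = guessed_literal a.
Proof.
apply: (iff_trans (List.in_map_iff _ _ _)); split.
  by case=> a [<- /In_mem]; rewrite mem_enum => sa; exists a.
by case=> a sa ->; exists a; split=> //; apply/In_mem; rewrite mem_enum.
Qed.

Lemma guessed_clauseP (A : structure tau)
    (rho : forall R : tau, (arity R).-tuple A -> Prop) (w : 'I_n -> A)
    (s : {set bool * ratom}) :
  clause_holds (A := expansion rho) w (guessed_clause s) <->
  exists b R (x : (arity R).-tuple 'I_n),
    (b, ratom_of x) \in s /\ (rho R (map_tuple w x) <-> b).
Proof.
split=> [[_ /In_guessed [[b [R x]] sa ->] la]|[b [R [x [sa la]]]]].
  by exists b, R, x; split=> //; case: b la {sa} => /=; split.
exists (guessed_literal (b, ratom_of x)).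
  by apply/In_guessed; exists (b, ratom_of x).
by case: b la {sa} => la; [exact: (iffRL la) | move=> /(iffLR la)].
Qed.

Variables (M : structure tau) (v : 'I_n -> M) (idx : M -> 'I_n).
Hypothesis idxK : forall i, v (idx (v i)) = v i.

(** The clause of this set negates the diagram, hence the negation in the
    second condition.  Several variables may have the same value under [v]; the
    first condition retains one variable, [idx a], for each value [a].  Without it
    the clause could be disconnected, since two variables with the same value
    need not be linked by a tuple. *)
Definition diagram : {set bool * ratom} :=
  [set l : bool * ratom |
    all (fun i => idx (v i) == i) (tagged l.2 : (arity _).-tuple 'I_n)
           & l.1 == ~~ `[< rel_of (map_tuple v (tagged l.2)) >]].

Lemma map_idxK m (t : m.-tuple M) :
  within v t -> map_tuple v (map_tuple idx t) = t.
Proof.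
move=> vt; apply: eq_from_tnth => k; rewrite !tnth_map.
by have [i <-] := vt k.
Qed.

Lemma in_diagram b R (t : (arity R).-tuple M) : within v t ->
  (b, ratom_of (map_tuple idx t)) \in diagram <-> (rel_of t <-> ~~ b).
Proof.
move=> vt; rewrite inE /= map_idxK // (_ : all _ _); last first.
  apply/all_tnthP => k; rewrite tnth_map.
  by have [i <-] := vt k; rewrite idxK.
by case: asboolP => Rt; case: b; split=> //= [[]]; intuition.
Qed.

Lemma diagram_mem b R (x : (arity R).-tuple 'I_n) :
  (b, ratom_of x) \in diagram ->
  (forall k, idx (v (tnth x k)) = tnth x k) /\
  (rel_of (map_tuple v x) <-> ~~ b).
Proof.
rewrite inE /= => /andP [/all_tnthP idx_x /eqP ->]; split=> [k|].
  exact/eqP.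
by rewrite negbK; split=> /asboolP.
Qed.

(** A valuation [w] that falsifies the clause realises the diagram, so that
    [w \o idx] is a strong map on the range of [v]. *)
Lemma diagram_fails (A : structure tau)
   (rho : forall R : tau, (arity R).-tuple A -> Prop) (w : 'I_n -> A) :
  ~ clause_holds (A := expansion rho) w (guessed_clause diagram) ->
  forall R (t : (arity R).-tuple M), within v t ->
    (rel_of t <-> rho R (map_tuple (w \o idx) t)).
Proof.
move=> fails R t vt.
have wE : map_tuple (w \o idx) t = map_tuple w (map_tuple idx t).
  by apply: eq_from_tnth => k; rewrite !tnth_map.
rewrite wE; split=> Rt; apply: contrapT => nRt; apply: fails.
  apply/guessed_clauseP; exists false, R, (map_tuple idx t); split=> //.
  by apply/in_diagram.
by apply/guessed_clauseP; exists true, R, (map_tuple idx t); split=> //;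
  apply/in_diagram.
Qed.

End Diagrams.

(** A colouring is constant on the connected image of [F], and each separating
    tuple carries the colour of that image to its other entries. *)
Lemma diagram_connected (tau : signature) (n : nat) (F M : structure tau)
    (e : F -> M) (v : 'I_n -> M) (idx : M -> 'I_n) :
    (forall i, v (idx (v i)) = v i) -> embedding e -> connected F ->
    (forall f, exists i, v i = e f) ->
    (forall i, exists f, v i = e f \/
       exists R, exists t : (arity R).-tuple M,
         [/\ rel_of t, within v t,
             exists k, tnth t k = v i & exists k, tnth t k = e f]) ->
  connected (clause_structure (guessed_clause (diagram v idx))).
Proof.
move=> idxK [_ erel] connF ve linked; apply: connected_clause => c cmono.
have mono R (t : (arity R).-tuple M) : rel_of t -> within v t ->
    monochromatic (c \o idx) t.
  move=> Rt vt i j.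
  have /cmono mono_t : List.In
      (Neg (@Rel (sig_union tau tau) n (inr R) (map_tuple idx t)))
      (guessed_clause (diagram v idx)).
    apply/In_guessed; exists (false, ratom_of (map_tuple idx t)) => //.
    exact/in_diagram.
  by have := mono_t i j; rewrite !tnth_map.
have constF : forall f f', c (idx (e f)) = c (idx (e f')).
  apply: (connected_constant (c := c \o idx \o e)) => // R t Rt i j.
  have vt : within v (map_tuple e t) by move=> k; rewrite tnth_map.
  by have := mono _ _ (iffLR (erel R t) Rt) vt i j; rewrite !tnth_map.
have colour i f0 : c (idx (v i)) = c (idx (e f0)).
  have [f [->|[R [t [Rt vt [k tk] [k' tk']]]]]] := linked i; first exact: constF.
  by rewrite -tk -(constF f) -tk'; apply: mono.
have occurring i :
    var_in_clause (guessed_clause (diagram v idx)) i -> idx (v i) = i.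
  rewrite /var_in_clause /guessed_clause has_map.
  case/hasP=> [[b [R x]]]; rewrite mem_enum.
  move=> /(@diagram_mem _ _ _ _ _ b R x) [idx_x _].
  by case: b => /= /tnthP [k ->].
move=> i j /occurring <- /occurring <-.
have [f _] := linked i.
by rewrite (colour i f) (colour j f).
Qed.

(** * The sentence *)

Section Sentence.

Variables (tau : signature) (m : nat) (S : structure tau) (conn : Prop).

Let n := num_vars tau m.

Definition full_tuple (R : tau) : (arity R).-tuple 'I_n :=
  [tuple widen_ord (arity_le_num_vars m R) k | k < arity R].

Definition guess_extends (R : tau) : clause (sig_union tau tau) n :=
  extension_clause (erefl (arity R)) (full_tuple R).

(** The proposition [conn] lets one sentence serve for both fragments: it is
    false for the plain fragment and true for the connected one. *)
Definition admissible (s : {set bool * ratom tau n}) : Prop :=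
  (forall w : 'I_n -> S,
     clause_holds (A := expansion (@rel_of tau S)) w (guessed_clause s)) /\
  (conn -> connected (clause_structure (guessed_clause s))).

(** The quantified symbols are a copy of [tau]; the symbol [R] of [tau] is the
    input of its own copy. *)
Definition theory_sentence : snp_sentence tau :=
  @SNP tau tau n
    ([seq guess_extends R | R <- enum tau] ++
     [seq guessed_clause s | s <- enum {set bool * ratom tau n}
                           & `[< admissible s >]]).

Lemma In_theory C : List.In C (matrix_of theory_sentence) <->
  (exists R, C = guess_extends R) \/
  (exists2 s, admissible s & C = guessed_clause s).
Proof.
apply: (iff_trans (List.in_app_iff _ _ _)); split.
  case=> /List.in_map_iff [z [<-]]; first by left; exists z.
  by move/In_mem; rewrite mem_filter => /andP [/asboolP]; right; exists z.
case=> [[R ->]|[s ok_s ->]]; [left | right]; apply/List.in_map_iff.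
  by exists R; split=> //; apply/In_mem; rewrite mem_enum.
exists s; split=> //; apply/In_mem; rewrite mem_filter mem_enum andbT.
exact/asboolP.
Qed.

Lemma guess_extendsP (A : structure tau)
    (rho : forall R : tau, (arity R).-tuple A -> Prop) (w : 'I_n -> A) R :
  clause_holds (A := expansion rho) w (guess_extends R) <->
  (rel_of (map_tuple w (full_tuple R)) -> rho R (map_tuple w (full_tuple R))).
Proof.
split=> [[l /= [<-|[<-|//]] //=]|ext].
have [Rt|nRt] := pselect (rel_of (map_tuple w (full_tuple R))).
  by exists (Pos (@Rel (sig_union tau tau) n (inr R) (full_tuple R)));
    [right; left | exact: ext].
by exists (Neg (@Rel (sig_union tau tau) n (inl R) (full_tuple R))); [left|].
Qed.

Lemma theory_monotone : monotone theory_sentence.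
Proof.
move=> C a /In_theory [[R ->]|[s _ ->]].
  by move=> /= [//|[[<-]|//]].
by move=> /In_guessed [[[] [R x]] _ //= [->]].
Qed.

Lemma theory_extensional : extensional theory_sentence.
Proof.
exists id => // R; exists erefl, (full_tuple R); split.
- rewrite map_inj_uniq ?val_ord_tuple ?enum_uniq // => i j /(congr1 val) /=.
  exact: val_inj.
- by apply/In_theory; left; exists R.
pose head (a : atom (sig_union tau tau) n) :=
  if a is Rel R _ then Some R else None.
move=> C /In_theory [[R' ->]|[s _ ->]] neC [l inl_ [x lx]];
  have {lx} headl : head (atom_of l) = Some (inl R) by rewrite lx.
  case: inl_ headl => [<-|[<-|//]] //= [eqR]; apply: neC.
  by rewrite eqR.
by case/In_guessed: inl_ headl => [[[] [R' x']] _ ->].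
Qed.

Lemma theory_connected : conn -> connected_snp theory_sentence.
Proof.
move=> isconn C /In_theory [[R ->]|[s [_ /(_ isconn) conns] ->]]; split=> //.
- by move=> i j /= [//|[//|//]].
- apply: connected_clause => c cmono i j.
  have inx k : var_in_clause (guess_extends R) k ->
      exists k', k = tnth (full_tuple R) k'.
    rewrite /var_in_clause /= orbF => /orP [] /tnthP //.
  move=> /inx [k ->] /inx [k' ->].
  exact: (cmono (inl R) (full_tuple R) (or_introl erefl)).
- by move=> i j /In_guessed [[[] [R x]] _].
Qed.

(** The guess is the preimage of the relations of [S] under [h]. *)
Lemma theory_sound (A : structure tau) (h : A -> S) :
  homomorphism h -> models A theory_sentence.
Proof.
move=> hom_h; exists (fun R t => rel_of (map_tuple h t)) => w C.
case/In_theory=> [[R ->]|[s [valid_s _] ->]].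
  by apply/guess_extendsP; apply: hom_h.
apply/guessed_clauseP.
have /guessed_clauseP [b [R [x [sx Rx]]]] := valid_s (h \o w).
exists b, R, x; split=> //.
suff -> : map_tuple h (map_tuple w x) = map_tuple (h \o w) x by [].
by apply: eq_from_tnth => k; rewrite !tnth_map.
Qed.

Variable Fs : structure tau -> Prop.
Hypothesis boundS : set_of_bounds Fs S.
Hypothesis enumFs : forall F, Fs F ->
  exists p : 'I_m.+1 -> F, forall f, exists i, p i = f.
Hypothesis connFs : conn -> forall F, Fs F -> connected F.

(** If there is no homomorphism, the diagram of an untwinned copy of a bound
    in [(A, rho)] is an admissible clause that [rho] violates. *)
Lemma theory_complete (A : structure tau) :
    fin_structure A -> models A theory_sentence ->
  exists h : A -> S, homomorphism h.
Proof.
move=> finA [rho rhoP].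
have [[a0] _] := finA.
have rho_ext R (t : (arity R).-tuple A) : rel_of t -> rho R t.
  pose w (i : 'I_n) := nth a0 t i.
  have wE : map_tuple w (full_tuple R) = t.
    by apply: eq_from_tnth => k; rewrite tnth_map tnth_mktuple (tnth_nth a0).
  have /guess_extendsP : clause_holds (A := expansion rho) w (guess_extends R).
    by apply: rhoP; apply/In_theory; left; exists R.
  by rewrite wE.
pose M : structure tau := Structure rho.
have finM : fin_structure M by [].
have [[h hom_h]|[F FsF [e emb_e e_sep]]] := hom_or_untwinned_bound boundS finM.
  by exists h => R t /rho_ext; apply: hom_h.
have [p surj_p] := enumFs FsF; exfalso.
have [v [ve vsep linked]] := separating_cover e surj_p.
have [|idx idxP] := @choice M 'I_n (fun a j => forall i, v i = a -> v j = a).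
  move=> a; have [[i vi]|no] := pselect (exists i, v i = a); first by exists i.
  by have [i0 _] := ve (p ord0); exists i0 => i vi; case: no; exists i.
have idxK i : v (idx (v i)) = v i by apply: idxP.
(* By definition the diagram is realised by [v] itself. *)
suff adm : admissible (diagram v idx).
  have /guessed_clauseP [b [R [x [/diagram_mem [_ Mx] rx]]]] :
      clause_holds (A := expansion rho) v (guessed_clause (diagram v idx)).
    by apply: rhoP; apply/In_theory; right; exists (diagram v idx).
  by move: (iff_trans (iff_sym Mx) rx); case: (b) => -[f g];
    [have := g isT | have := f isT].
split=> [w|isconn]; last exact: diagram_connected (connFs isconn FsF) ve linked.
(* A realisation [w] of the diagram in [S] makes [w \o idx \o e] an embedding of
   the bound [F] in [S]. *)
apply: contrapT => fails; have strong := diagram_fails idxK fails.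
have [finF boundF] := boundS.
have /boundF [embF _] := finF F FsF.
apply: (embF _); last first.
  exists F => //; exists id; split=> // R t.
  suff -> : map_tuple id t = t by [].
  by apply: eq_from_tnth => k; rewrite tnth_map.
pose g := w \o idx; have [e_inj erel] := emb_e.
have no_sep f f' R (t : (arity R).-tuple M) : g (e f) = g (e f') ->
    ~ separates (e f) (e f') t.
  (* [g] does not see the substitution of [e f'] for [e f]. *)
  move=> gff' /vsep [R' [t' [Rt' [k tk nRt'] vt']]]; apply: nRt'.
  apply/strong.
    move=> i; rewrite tnth_mktuple; case: ifP => _; [exact: ve | exact: vt'].
  move/strong: (Rt') => /(_ vt').
  suff -> : map_tuple g (tset t' k (e f')) = map_tuple g t' by [].
  apply: eq_from_tnth => i; rewrite !tnth_map tnth_ord_tuple.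
  by case: eqP => // ->; rewrite tk gff'.
exists (g \o e); split=> [f f' gff'|R t].
  apply: e_sep; apply: contrapT => /not_twin [R [t [|]]]; exact: no_sep.
apply: (iff_trans (erel R t)).
suff -> : map_tuple (g \o e) t = map_tuple g (map_tuple e t).
  by apply: strong => k; rewrite tnth_map.
by apply: eq_from_tnth => k; rewrite !tnth_map.
Qed.

End Sentence.

Lemma CSP_theory (tau : signature) (S : structure tau) (conn : Prop)
    (Fs : seq (structure tau)) :
    set_of_bounds (fun F => List.In F Fs) S ->
    (conn -> forall F, List.In F Fs -> connected F) ->
  exists m, forall A, CSP S A <-> finite_models_of (theory_sentence m S conn) A.
Proof.
move=> boundS connFs; have [m enumFs] := common_enumeration (proj1 boundS).
exists m => A; split=> [[finA [h hom_h]]|[finA modA]]; split=> //.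
  exact: theory_sound hom_h.
exact: (theory_complete boundS enumFs connFs).
Qed.

Theorem corollary5p5 (tau : signature) (S : structure tau) (hS : nonempty S) :
  (finitely_bounded S -> in_monotone_extensional_SNP (CSP S)) /\
  (has_finite_connected_bounds S ->
     in_monotone_connected_extensional_SNP (CSP S)).
Proof.
split=> [[Fs boundS]|[Fs [boundS connFs]]].
  have [//|m CSP_S] := @CSP_theory tau S False Fs boundS.
  exists (theory_sentence m S False); split=> //.
    exact: theory_monotone.
  exact: theory_extensional.
have [|m CSP_S] := @CSP_theory tau S True Fs boundS; first by move=> _.
exists (theory_sentence m S True); split=> //.
- exact: theory_monotone.
- exact: theory_connected.
- exact: theory_extensional.
Qed.
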